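(* Let $t\ge 1$ and let $m_1,\dots,m_t\ge 3$ and $n_1,\dots,n_t\ge 0$ be integers such that $m_t\equiv 0\pmod 2$ and, if $t\ge 2$, $m_i\equiv 0\pmod 4$ and $n_i\equiv 0\pmod 2$ for $i=1,\dots,t-1$. Then the graph $C_{m_1,(n_1),m_2,(n_2),\dots,m_t,(n_t)}$ admits a uniformly ordered labeling.
   Context: $\mathbb N=\{0,1,2,\dots\}$; for integers $a\le b$, $[a,b]=\{x\in\mathbb N: a\le x\le b\}$. For integers $m_1,\dots,m_t\ge3$, $n_1,\dots,n_t\ge0$, the graph $C_{m_1,(n_1),\dots,m_t,(n_t)}$ has $m_1+\dots+m_t+n_1+\dots+n_t-(t-1)$ vertices and $m_1+\dots+m_t+n_1+\dots+n_t$ edges, and consists of $t$ cycles $C_{m_1},\dots,C_{m_t}$ (of lengths $m_i$) and $t$ paths $P_{n_1+1},\dots,P_{n_t+1}$ ($P_{n_i+1}$ has $n_i+1$ vertices) such that: the cycle $C_{m_1}$ has exactly one vertex in common with $P_{n_1+1}$; for each $i=1,\dots,t-1$ the path $P_{n_i+1}$ has one end vertex in common with $C_{m_i}$ and its other end vertex in common with $C_{m_{i+1}}$ (for $n_i=0$ these coincide); for each $i=2,\dots,t$ the cycle $C_{m_i}$ has one vertex in common with $P_{n_{i-1}+1}$ and one with $P_{n_i+1}$, and these two vertices are at distance $2$; $P_{n_t+1}$ has an end vertex on $C_{m_t}$; no other vertices are shared among cycles and paths. For a graph $G=(V,E)$ with $|E|=m'$ and $t'\in\mathbb N$, a labeling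 is an injective map $f\colon V\to[0,t']$; it induces $\tilde f(\{u,v\})=|f(u)-f(v)|$. $f$ is a $\overline{\rho}$-labeling if (a) $t'\ge 2m'$, (b) $\tilde f$ is injective, (c) there is no $i\in\{1,\dots,m'\}$ with both $i$ and $t'+1-i$ in $\operatorname{Im}\tilde f$. If $G$ is bipartite with vertex bipartition $\{A,B\}$, an $(A,B,t')$-uniformly ordered labeling is a $\overline{\rho}$-labeling $f\colon V\to[0,t']$ for which there is $\lambda\in\mathbb N$ with $f(a)\le\lambda$ for all $a\in A$ and $f(b)>\lambda$ for all $b\in B$. A uniformly ordered labeling of a bipartite graph $G$ with $m'$ edges is a labeling $f\colon V\to[0,2m']$ that is $(A,B,2m')$-uniformly ordered for some vertex bipartition $\{A,B\}$ of $G$. *)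

(* Defs.v *)
From mathcomp Require Import all_boot all_order all_algebra.

Set Implicit Arguments.
Unset Strict Implicit.
Unset Printing Implicit Defensive.

(* A graph is a finType [T] of vertices with an adjacency relation [e : rel T],
   assumed symmetric and irreflexive where it is used. *)

Section Graphs.
Variables (T : finType) (e : rel T).

Definition edges : {set {set T}} := [set [set u; v] | u in T, v in T & e u v].

Definition at_distance (d : nat) (x y : T) : Prop :=
  (exists2 p : seq T, path e x p & last x p = y /\ size p = d) /\
  (forall p : seq T, path e x p -> last x p = y -> d <= size p).

Definition bipartition (A B : {set T}) : Prop :=
  [/\ A :|: B = [set: T], [disjoint A & B] &
      forall u v, e u v ->
        (u \in A) && (v \in B) || (u \in B) && (v \in A)].

Definition labeling (t : nat) (f : T -> nat) : Prop :=
  injective f /\ (forall v, f v <= t).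

Definition edge_label (f : T -> nat) (u v : T) : nat := `|f u - f v|%N.

Definition in_edge_labels (f : T -> nat) (i : nat) : Prop :=
  exists u v, e u v /\ edge_label f u v = i.

Definition rho_bar_labeling (t : nat) (f : T -> nat) : Prop :=
  [/\ labeling t f,
      2 * #|edges| <= t,
      forall u v x y, e u v -> e x y ->
        edge_label f u v = edge_label f x y -> [set u; v] = [set x; y] &
      ~ (exists2 i, 1 <= i <= #|edges| &
           in_edge_labels f i /\ in_edge_labels f (t + 1 - i))].

Definition uniformly_ordered_for (A B : {set T}) (t : nat) (f : T -> nat) :
    Prop :=
  rho_bar_labeling t f /\
  exists lambda : nat,
    (forall a, a \in A -> f a <= lambda) /\
    (forall b, b \in B -> lambda < f b).

Definition uniformly_ordered_labeling (f : T -> nat) : Prop :=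
  exists A B : {set T},
    bipartition A B /\ uniformly_ordered_for A B (2 * #|edges|) f.

(* [s] lists the vertices of a cycle, resp. path, in order. *)
Definition cycle_adj (s : seq T) (u v : T) : bool :=
  (u \in s) && (v == next s u) || (v \in s) && (u == next s v).

Definition path_adj (s : seq T) (u v : T) : bool :=
  infix [:: u; v] s || infix [:: v; u] s.

(* [e] is the graph C_{m_1,(n_1),...,m_t,(n_t)}: [C i] lists the vertices of
   the i-th cycle, and [P i] those of the i-th path, from the i-th to the
   (i+1)-th cycle. Indices run over 1, ..., t; the values of [m], [n], [C], [P]
   elsewhere are irrelevant. Since each [P i] is nonempty, its end vertices are
   [head x (P i)] and [last x (P i)] for any default [x]. *)
Definition cycle_chain_decomposition (t : nat) (m n : nat -> nat)
    (C P : nat -> seq T) : Prop :=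
  let idx i := 1 <= i <= t in
  [/\ forall i, idx i ->
        [/\ uniq (C i), size (C i) = m i, uniq (P i) & size (P i) = (n i).+1],
      (forall x, exists2 i, idx i & (x \in C i) || (x \in P i)) /\
      (forall x y, e x y <->
         exists2 i, idx i & cycle_adj (C i) x y || path_adj (P i) x y),
      (forall i x, idx i -> head x (P i) \in C i) /\
      (forall i x, 1 <= i < t -> last x (P i) \in C i.+1),
      [/\ forall i j x, idx i -> idx j -> x \in C i -> x \in P j ->
            (i = j /\ x = head x (P j)) \/ (i = j.+1 /\ x = last x (P j)),
          forall i j x, idx i -> idx j -> i < j -> x \in C i -> x \in C j ->
            j = i.+1 /\ x \in P i &
          forall i j x, idx i -> idx j -> x \in P i -> x \in P j -> i = j] &
      forall i x, 1 <= i < t ->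
        at_distance 2 (last x (P i)) (head x (P i.+1))].

Definition is_cycle_chain (t : nat) (m n : nat -> nat) : Prop :=
  [/\ #|T| = \sum_(1 <= i < t.+1) m i + \sum_(1 <= i < t.+1) n i - (t - 1),
      #|edges| = \sum_(1 <= i < t.+1) m i + \sum_(1 <= i < t.+1) n i &
      exists C P : nat -> seq T, cycle_chain_decomposition t m n C P].

End Graphs.

(* Main.v *)
Require Import Defs.
From mathcomp Require Import all_boot all_order all_algebra.
From mathcomp Require Import zify.

Set Implicit Arguments.
Unset Strict Implicit.
Unset Printing Implicit Defensive.

(* The labels <= lam form the low side A, the others the high side B, so adding
   a constant to the whole high side shifts all edge labels by that constant.
   Hence two ordered labelings can be nested: raise the high side of the outer
   one far enough to insert the inner one in the gap, identifying the vertex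
   labeled 0 of the inner graph with the vertex labeled lam of the outer one.
   The graph is built from the inside as C_1, P_1, C_2, ..., C_t, P_t.
   - A path with n edges has a zigzag labeling with edge labels 1..n whose first
     vertex is labeled lam and, when n is even, whose last vertex is labeled 0.
   - C_{4k} has one with edge labels 1..4k in which the vertices labeled 0 and
     lam are at distance 2, as are the two attachments of a cycle.
   - C_{4k+2} has a similar one with edge labels 1..4k+1 and 4k+3: labels
     1..4k+2 are impossible for parity reasons, and 4k+2 is exchanged with its
     partner for the sum 2(4k+2)+1.
   If P_t has q edges and the rest of the graph E2 edges, the last nesting
   shifts the inner edge labels by q and those of P_t by 2 E2 + q: these become
   the top q labels, and the pairs of sum 2 E2 + 1 become pairs of sum
   2 (E2 + q) + 1. *)

(** * Zigzag labelings of paths and even cycles, on integer positions *)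

Definition cyc_step m i j :=
  [|| j == i.+1, i == j.+1, (i == 0) && (j == m.-1) | (j == 0) && (i == m.-1)].

Definition lin_step i j := (j == i.+1) || (i == j.+1).

Definition zigzag_path lam i := if odd i then lam + i./2 + 1 else lam - i./2.

(* One value is skipped on the high side, at position 2k+1, so that the edge
   closing the cycle gets the missing label. *)
Definition zigzag_cycle0 k i :=
  if odd i then 4 * k - i./2 - (k <= i./2) else i./2.

(** Besides the skip on the high side, the value 1 is skipped on the low side: the first two edges
    get the labels 4k+3 and 4k+1, so 4k+2 drops out. *)
Definition zigzag_cycle2 k i :=
  if odd i then 4 * k + 3 - i./2 - (k <= i./2) else i./2 + (0 < i).

(* [ordered] below, for a graph on the positions 0, ..., M - 1. *)
Record zigzag (M : nat) (step : rel nat) (g : nat -> nat) (lam N : nat)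
    (L : nat -> Prop) : Prop := Zigzag {
  zz_inj : {in gtn M &, injective g};
  zz_le : forall i, i < M -> g i <= N;
  zz_lam : lam <= N;
  zz_adj : forall i j, i < M -> j < M -> step i j ->
    (g i <= lam) != (g j <= lam);
  zz_uniq : forall i j i' j', i < M -> j < M -> i' < M -> j' < M ->
    step i j -> step i' j' -> g i <= lam -> g i' <= lam ->
    g j - g i = g j' - g i' -> i = i' /\ j = j';
  zz_label : forall i j, i < M -> j < M -> step i j -> g i <= lam ->
    L (g j - g i) }.

(** This view and the next three turn parities and halves into linear equations, so that the
    properties of zigzags reduce to linear arithmetic. *)
Variant parity_spec i : bool -> nat -> Prop :=
  | Even a of i = 2 * a : parity_spec i false a
  | Odd a of i = 2 * a + 1 : parity_spec i true a.

Lemma parityP i : parity_spec i (odd i) i./2.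
Proof. by have := odd_double_half i; case: odd => <-; constructor; lia. Qed.

Variant zigzag_path_spec lam i : nat -> Prop :=
  | ZPeven a of i = 2 * a : zigzag_path_spec lam i (lam - a)
  | ZPodd a of i = 2 * a + 1 : zigzag_path_spec lam i (lam + a + 1).

Lemma zigzag_pathP lam i : zigzag_path_spec lam i (zigzag_path lam i).
Proof. by rewrite /zigzag_path; case: parityP => a ->; constructor. Qed.

Variant zigzag_cycle0_spec k i : nat -> Prop :=
  | Z0even a of i = 2 * a : zigzag_cycle0_spec k i a
  | Z0small a of i = 2 * a + 1 & a < k : zigzag_cycle0_spec k i (4 * k - a)
  | Z0large a of i = 2 * a + 1 & k <= a :
    zigzag_cycle0_spec k i (4 * k - a - 1).

Lemma zigzag_cycle0P k i : zigzag_cycle0_spec k i (zigzag_cycle0 k i).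
Proof.
rewrite /zigzag_cycle0; case: parityP => a ->; first by constructor.
by case: leqP => ka /=; rewrite ?subn0; constructor.
Qed.

Variant zigzag_cycle2_spec k i : nat -> Prop :=
  | Z2zero of i = 0 : zigzag_cycle2_spec k i 0
  | Z2even a of i = 2 * a & 0 < a : zigzag_cycle2_spec k i (a + 1)
  | Z2small a of i = 2 * a + 1 & a < k : zigzag_cycle2_spec k i (4 * k + 3 - a)
  | Z2large a of i = 2 * a + 1 & k <= a :
    zigzag_cycle2_spec k i (4 * k + 2 - a).

Lemma zigzag_cycle2P k i : zigzag_cycle2_spec k i (zigzag_cycle2 k i).
Proof.
rewrite /zigzag_cycle2; case: parityP => a ->.
  by case: a => [|a] /=; constructor.
case: leqP => ka /=; last by rewrite subn0; constructor.
by have -> : 4 * k + 3 - a - 1 = 4 * k + 2 - a by [lia]; constructor.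
Qed.

Lemma half_bounds n : 2 * n./2 <= n <= 2 * n./2 + 1.
Proof. by case: parityP => a ->; lia. Qed.

(** The edge joining positions [i] and [i + 1] gets the label [i + 1]. *)
Lemma zigzag_path_zigzag n :
  zigzag n.+1 lin_step (zigzag_path n./2) n./2 n (fun l => 1 <= l <= n).
Proof.
move: n./2 (half_bounds n) => h hP; rewrite /lin_step; split.
- by move=> i j; rewrite !inE => Hi Hj; do 2!case: zigzag_pathP => ? ?; lia.
- by move=> i Hi; case: zigzag_pathP => ? Ei; lia.
- lia.
- by move=> i j Hi Hj Hs; do 2!case: zigzag_pathP => ? ?; lia.
- move=> i j i' j' Hi Hj Hi' Hj' Hs Hs'.
  case: (zigzag_pathP h i) => ? ?; last lia.
  case: (zigzag_pathP h i') => ? ?; last lia.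
  by do 2!case: zigzag_pathP => ? ?; lia.
- by move=> i j Hi Hj Hs; do 2!case: zigzag_pathP => ? ?; lia.
Qed.

(** Walking from position 0, the labels run down from 4k to 2k+1 and, after the skip, from 2k-1 to
    1; the closing edge supplies 2k. As [i] is even, the parity and the range of [d] separate the
    cases. *)
Lemma zigzag_cycle0_step k i j : 0 < k -> i < 4 * k -> j < 4 * k ->
  cyc_step (4 * k) i j -> zigzag_cycle0 k i <= (2 * k).-1 ->
  let d := zigzag_cycle0 k j - zigzag_cycle0 k i in
  ~~ odd i /\
  [\/ [/\ j = i.+1, i < 2 * k & i + d = 4 * k],
      [/\ j = i.+1, 2 * k <= i & i + d = 4 * k - 1],
      [/\ i = j.+1, i <= 2 * k & i + d = 4 * k + 1] |
      [/\ i = j.+1, 2 * k < i & i + d = 4 * k] \/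
      [/\ i = 0, j = 4 * k - 1 & d = 2 * k]].
Proof.
move=> k0 Hi Hj; rewrite /cyc_step => st.
case: (zigzag_cycle0P k i) => [a Ea|a Ea ka|a Ea ka] le_i /=; [|lia|lia].
split; first by rewrite Ea mul2n odd_double.
case/or4P: st => st.
- have Ej : j = 2 * a + 1 by lia.
  case: zigzag_cycle0P => [b Eb|b Eb kb|b Eb kb]; first lia.
  + by apply: Or41; split; lia.
  + by apply: Or42; split; lia.
- case: zigzag_cycle0P => [b Eb|b Eb kb|b Eb kb]; first lia.
  + by apply: Or43; split; lia.
  + by apply: Or44; left; split; lia.
- case: zigzag_cycle0P => [b Eb|b Eb kb|b Eb kb]; [lia|lia|].
  by apply: Or44; right; split; lia.
- lia.
Qed.

Lemma zigzag_cycle0_zigzag k : 0 < k ->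
  zigzag (4 * k) (cyc_step (4 * k)) (zigzag_cycle0 k) (2 * k).-1 (4 * k)
    (fun l => 1 <= l <= 4 * k).
Proof.
move=> k0; split.
- by move=> i j; rewrite !inE => Hi Hj; do 2!case: zigzag_cycle0P => ? ?; lia.
- by move=> i Hi; case: zigzag_cycle0P => ? ?; lia.
- lia.
- move=> i j Hi Hj; rewrite /cyc_step => Hs; do 2!case: zigzag_cycle0P => ? ?;
    lia.
- move=> i j i' j' Hi Hj Hi' Hj' Hs Hs' le_i le_i' eq_d.
  case: (zigzag_cycle0_step k0 Hi Hj Hs le_i); rewrite eq_d => ei S.
  case: (zigzag_cycle0_step k0 Hi' Hj' Hs' le_i') => ei' S'.
  move: S S' ei ei'; move: (_ - _) => d; clear - k0.
  by case=> [[? ? ?]|[? ? ?]|[? ? ?]|[[? ? ?]|[? ? ?]]]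
     [[? ? ?]|[? ? ?]|[? ? ?]|[[? ? ?]|[? ? ?]]]; lia.
- move=> i j Hi Hj Hs le_i.
  case: (zigzag_cycle0_step k0 Hi Hj Hs le_i) => _; move: (_ - _) => d;
    clear le_i => /=.
  by case=> [[? ? ?]|[? ? ?]|[? ? ?]|[[? ? ?]|[? ? ?]]]; lia.
Qed.

(** Here the labels along the walk are 4k+3, then 4k+1 down to 2k+3, then 2k+1 down to 1; the
    closing edge supplies 2k+2. The term [i == 0] accounts for the skip on the low side. *)
Lemma zigzag_cycle2_step k i j : 0 < k -> i < 4 * k + 2 -> j < 4 * k + 2 ->
  cyc_step (4 * k + 2) i j -> zigzag_cycle2 k i <= (2 * k).+1 ->
  let d := zigzag_cycle2 k j - zigzag_cycle2 k i in
  ~~ odd i /\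
  [\/ [/\ j = i.+1, i < 2 * k & i + d = 4 * k + 2 + (i == 0)],
      [/\ j = i.+1, 2 * k <= i & i + d = 4 * k + 1],
      [/\ i = j.+1, i <= 2 * k & i + d = 4 * k + 3] |
      [/\ i = j.+1, 2 * k < i & i + d = 4 * k + 2] \/
      [/\ i = 0, j = 4 * k + 1 & d = 2 * k + 2]].
Proof.
move=> k0 Hi Hj; rewrite /cyc_step => st.
case: (zigzag_cycle2P k i) => [Ei|a Ei a0|a Ei ka|a Ei ka] le_i /=;
  [| |lia|lia].
- split; first by rewrite Ei.
  case/or4P: st => st; [|lia| |lia].
  + case: zigzag_cycle2P => [Eb|b Eb b0|b Eb kb|b Eb kb]; [lia|lia| |lia].
    by apply: Or41; split; lia.
  + case: zigzag_cycle2P => [Eb|b Eb b0|b Eb kb|b Eb kb]; [lia|lia|lia|].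
    by apply: Or44; right; split; lia.
split; first by rewrite Ei mul2n odd_double.
case/or4P: st => st; [| |lia|lia].
- case: zigzag_cycle2P => [Eb|b Eb b0|b Eb kb|b Eb kb]; [lia|lia| |].
  + by apply: Or41; split; lia.
  + by apply: Or42; split; lia.
- case: zigzag_cycle2P => [Eb|b Eb b0|b Eb kb|b Eb kb]; [lia|lia| |].
  + by apply: Or43; split; lia.
  + by apply: Or44; left; split; lia.
Qed.

Lemma zigzag_cycle2_zigzag k : 0 < k ->
  zigzag (4 * k + 2) (cyc_step (4 * k + 2)) (zigzag_cycle2 k) (2 * k).+1
    (4 * k + 3) (fun l => (1 <= l <= 4 * k + 1) || (l == 4 * k + 3)).
Proof.
move=> k0; split.
- by move=> i j; rewrite !inE => Hi Hj;
    do 2!case: zigzag_cycle2P => [?|? ? ?|? ? ?|? ? ?]; lia.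
- by move=> i Hi; case: zigzag_cycle2P => [?|? ? ?|? ? ?|? ? ?]; lia.
- lia.
- move=> i j Hi Hj; rewrite /cyc_step => Hs;
    do 2!case: zigzag_cycle2P => [?|? ? ?|? ? ?|? ? ?]; lia.
- move=> i j i' j' Hi Hj Hi' Hj' Hs Hs' le_i le_i' eq_d.
  case: (zigzag_cycle2_step k0 Hi Hj Hs le_i); rewrite eq_d => ei S.
  case: (zigzag_cycle2_step k0 Hi' Hj' Hs' le_i') => ei' S'.
  move: S S' ei ei'; move: (_ - _) => d; clear - k0.
  by case=> [[? ? ?]|[? ? ?]|[? ? ?]|[[? ? ?]|[? ? ?]]]
     [[? ? ?]|[? ? ?]|[? ? ?]|[[? ? ?]|[? ? ?]]]; lia.
- move=> i j Hi Hj Hs le_i.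
  case: (zigzag_cycle2_step k0 Hi Hj Hs le_i); move: (_ - _) => d;
    clear le_i => /=.
  by move=> ei; case=> [[? ? ?]|[? ? ?]|[? ? ?]|[[? ? ?]|[? ? ?]]]; lia.
Qed.

(** * Ordered labelings of graphs and their nesting *)

(** Edges are always read from their low end, where the truncated [f v - f u] is the true edge
    label. *)
Record ordered (T : finType) (V : {set T}) (r : T -> T -> Prop) (f : T -> nat)
    (lam N : nat) (L : nat -> Prop) : Prop := Ordered {
  ord_inj : {in V &, injective f};
  ord_le : forall v, v \in V -> f v <= N;
  ord_lam : lam <= N;
  ord_adj : forall u v, r u v ->
    [/\ u \in V, v \in V & (f u <= lam) != (f v <= lam)];
  ord_uniq : forall u v x y, r u v -> r x y -> f u <= lam -> f x <= lam ->
    f v - f u = f y - f x -> u = x /\ v = y;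
  ord_label : forall u v, r u v -> f u <= lam -> L (f v - f u) }.

Section Ordered.
Variable T : finType.
Implicit Types (V : {set T}) (r : T -> T -> Prop) (f : T -> nat) (s : seq T).

Lemma ordered_zigzag s r step g lam N L :
    zigzag (size s) step g lam N L ->
    (forall u v, r u v ->
       [/\ u \in s, v \in s & step (index u s) (index v s)]) ->
  ordered [set v in s] r (fun v => g (index v s)) lam N L.
Proof.
case=> inj le lamN adj unq lab rs.
have idx u : u \in s -> index u s < size s by rewrite index_mem.
have idx_inj u v : u \in s -> v \in s -> index u s = index v s -> u = v.
  by move=> us vs E; rewrite -(nth_index u us) E nth_index.
split=> //.
- move=> u v; rewrite !inE => us vs E; apply: idx_inj => //.
  by apply: inj => //; rewrite inE idx.
- by move=> v; rewrite inE => vs; apply/le/idx.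
- move=> u v /rs[us vs st]; rewrite !inE; split=> //.
  by apply: adj => //; apply: idx.
- move=> u v x y /rs[us vs uv] /rs[xs ys xy] lu lx E.
  have [] := unq _ _ _ _ (idx _ us) (idx _ vs) (idx _ xs) (idx _ ys)
    uv xy lu lx E.
  by move=> /idx_inj-> // /idx_inj->.
- by move=> u v /rs[us vs uv] lu; apply: lab => //; apply: idx.
Qed.

(** Block 1 is the outer one. The condition [N2 + d2 <= d1] does two jobs: it keeps the raised high
    side of block 1 above all of block 2, and it keeps the edge labels of block 1, now above [d1],
    apart from those of block 2. The last conclusion lets a low vertex labeled 0 survive for the
    next nesting. *)
Lemma ordered_glue V1 V2 r1 r2 f1 f2 lam1 lam2 N1 N2 d1 d2
    (L1 L2 L : nat -> Prop) y :
    ordered V1 r1 f1 lam1 N1 L1 -> ordered V2 r2 f2 lam2 N2 L2 ->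
    V1 :&: V2 = [set y] -> f1 y = lam1 -> f2 y = 0 -> N2 + d2 <= d1 ->
    (forall l, L1 l -> L (l + d1)) -> (forall l, L2 l -> L (l + d2)) ->
  exists f, ordered (V1 :|: V2) (fun u v => r1 u v \/ r2 u v) f
              (lam1 + lam2) (N1 + d1) L
    /\ forall v, v \in V1 -> f1 v <= lam1 -> f v = f1 v.
Proof.
move=> [inj1 le1 lamN1 adj1 unq1 lab1] [inj2 le2 lamN2 adj2 unq2 lab2] V12 f1y
  f2y d12 LL1 LL2.
have /setIP[y1 y2] : y \in V1 :&: V2 by rewrite V12 set11.
pose sh l d x := if x <= l then x else x + d.
(* On the shared vertex [y] both branches give [lam1]. *)
pose f v := if v \in V1 then sh lam1 d1 (f1 v) else lam1 + sh lam2 d2 (f2 v).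
have E1 v : v \in V1 -> f v = sh lam1 d1 (f1 v) by rewrite /f => ->.
have E2 v : v \in V2 -> f v = lam1 + sh lam2 d2 (f2 v).
  rewrite /f; case: ifP => // v1 v2.
  have /set1P-> : v \in [set y] by rewrite -V12 inE v1 v2.
  by rewrite f1y f2y /sh leqnn leq0n addn0.
have P1 v : v \in V1 ->
    f1 v <= lam1 /\ f v = f1 v \/ lam1 < f1 v /\ f v = f1 v + d1.
  by move=> v1; rewrite E1 // /sh; case: leqP => ?; [left|right].
have P2 v : v \in V2 ->
    f2 v <= lam2 /\ f v = lam1 + f2 v \/ lam2 < f2 v /\ f v = lam1 + f2 v + d2.
  by move=> v2; rewrite E2 // /sh; case: leqP => ?; [left|right; rewrite addnA].
have inj12 u v : u \in V1 -> v \in V2 -> f u = f v -> u = v.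
  move=> u1 v2; have := le2 _ v2.
  case: (P1 _ u1) (P2 _ v2) => [[lu fu]|[lu fu]] [[lv fv]|[lv fv]] lN E;
    try lia.
  (* Only two low vertices can collide, and then [f1 u <= lam1 <= lam1 + f2 v] forces [f1 u = lam1]
     and [f2 v = 0]. *)
  have -> : u = y by apply: inj1 => //; lia.
  by apply: inj2 => //; lia.
exists f; split; last by move=> v v1 lv; rewrite E1 // /sh lv.
split.
- move=> u v /setUP[u1|u2] /setUP[v1|v2]; last 1 first.
  + case: (P2 _ u2) (P2 _ v2) => [[lu fu]|[lu fu]] [[lv fv]|[lv fv]] E;
      apply: inj2 => //; lia.
  + case: (P1 _ u1) (P1 _ v1) => [[lu fu]|[lu fu]] [[lv fv]|[lv fv]] E;
      apply: inj1 => //; lia.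
  + exact: inj12.
  + by move/esym/inj12 => ->.
- move=> v /setUP[v1|v2].
  + by have := le1 _ v1; case: (P1 _ v1); lia.
  + by have := le2 _ v2; case: (P2 _ v2); lia.
- lia.
- move=> u v [/adj1[u1 v1]|/adj2[u2 v2]] uv; split;
    rewrite ?inE ?u1 ?v1 ?u2 ?v2 ?orbT //.
  + case: (P1 _ u1) (P1 _ v1) => [[lu fu]|[lu fu]] [[lv fv]|[lv fv]]; lia.
  + case: (P2 _ u2) (P2 _ v2) => [[lu fu]|[lu fu]] [[lv fv]|[lv fv]]; lia.
- have Q1 u v : r1 u v -> f u <= lam1 + lam2 ->
      [/\ f1 u <= lam1, lam1 < f1 v & f v - f u = f1 v - f1 u + d1].
    move=> /adj1[u1 v1 uv]; case: (P1 _ u1) (P1 _ v1) =>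
      [[lu fu]|[lu fu]] [[lv fv]|[lv fv]]; try lia.
    by move=> _; split => //; lia.
  have Q2 u v : r2 u v -> f u <= lam1 + lam2 ->
      [/\ f2 u <= lam2, lam2 < f2 v, f2 v <= N2 & f v - f u = f2 v - f2 u + d2].
    move=> /adj2[u2 v2 uv]; case: (P2 _ u2) (P2 _ v2) =>
      [[lu fu]|[lu fu]] [[lv fv]|[lv fv]]; try lia.
    by move=> _; split => //; [exact: le2 | lia].
  move=> u v x z [uv|uv] [xz|xz] lu lx.
  + case: (Q1 _ _ uv lu) (Q1 _ _ xz lx) => a b -> [c d ->] /addIn; exact: unq1.
  (* Mixed pairs: labels from [r1] exceed [d1], labels from [r2] are at most [N2 + d2]. *)
  + by case: (Q1 _ _ uv lu) (Q2 _ _ xz lx) => a b -> [c d h ->]; lia.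
  + by case: (Q2 _ _ uv lu) (Q1 _ _ xz lx) => a b h -> [c d ->]; lia.
  + case: (Q2 _ _ uv lu) (Q2 _ _ xz lx) => a b h -> [c d h' ->] /addIn;
      exact: unq2.
- move=> u v [uv|uv] lu.
  + have [u1 v1 ruv] := adj1 _ _ uv.
    have : f1 u <= lam1 by case: (P1 _ u1); lia.
    move/(lab1 _ _ uv)/LL1; congr L.
    case: (P1 _ u1) (P1 _ v1) => [[? fu]|[? fu]] [[? fv]|[? fv]]; lia.
  + have [u1 v1 ruv] := adj2 _ _ uv.
    have : f2 u <= lam2 by case: (P2 _ u1); lia.
    move/(lab2 _ _ uv)/LL2; congr L.
    case: (P2 _ u1) (P2 _ v1) => [[? fu]|[? fu]] [[? fv]|[? fv]]; lia.
Qed.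

Lemma ordered_eq V r V' r' f lam N L :
    V = V' -> (forall u v, r' u v <-> r u v) ->
  ordered V r f lam N L -> ordered V' r' f lam N L.
Proof.
move=> <- rr' [inj le lamN adj unq lab]; split=> //.
- by move=> u v /rr'/adj.
- by move=> u v x y /rr' uv /rr'; apply: unq.
- by move=> u v /rr'; apply: lab.
Qed.

(** Orienting each edge from its low end replaces the absolute difference by the one that [L]
    controls; condition (c) then follows from the assumption that no two values in [L] are
    partners. *)
Lemma ordered_uniformly (e : rel T) f lam N L :
    let E := #|edges e| in
    ordered [set: T] e f lam N L -> symmetric e -> N <= 2 * E ->
    (forall l, L l -> ~ L (2 * E + 1 - l)) ->
  uniformly_ordered_labeling e f.
Proof.
move=> E [inj le lamN adj unq lab] esym NE tr.
pose A := [set v | f v <= lam].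
exists A, (~: A); split.
  split; first exact: setUCr.
    by rewrite -setI_eq0 setICr.
  by move=> u v /adj[_ _]; rewrite !inE; do 2!case: (_ <= lam).
split; last by exists lam; split=> v; rewrite !inE // ltnNge.
have orient u v : e u v -> exists x z, [/\ e x z, f x <= lam, lam < f z,
    [set u; v] = [set x; z] & edge_label f u v = f z - f x].
  move=> uv; have [_ _] := adj _ _ uv; rewrite /edge_label.
  case: (leqP (f u) lam) (leqP (f v) lam) => lu [] lv // _.
    by exists u, v; split=> //; lia.
  by exists v, u; split=> //; [rewrite esym|rewrite setUC|lia].
split=> //.
- split; first by move=> u v; apply: inj; rewrite inE.
  by move=> v; apply: leq_trans (le v _) NE; rewrite inE.
- move=> u v x y /orient[u' [v' [uv lu _ -> ->]]] /orient
    [x' [y' [xy lx _ -> ->]]].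
  by move=> /(unq _ _ _ _ uv xy lu lx)[-> ->].
- case=> i _ [[u [v [/orient[u' [v' [uv lu _ _ ->]]] iE]]]].
  case=> [x [y [/orient[x' [y' [xy lx _ _ ->]]] jE]]].
  have Li : L i by rewrite -iE; apply: lab.
  by apply: (tr i Li); rewrite -jE; apply: lab.
Qed.

(** * Paths and cycles given as vertex lists *)

Lemma path_adj_step s u v : uniq s -> path_adj s u v ->
  [/\ u \in s, v \in s & lin_step (index u s) (index v s)].
Proof.
rewrite /path_adj /lin_step => us.
wlog uv : u v / infix [:: u; v] s.
  move=> W /orP[] uv; first by apply: W; rewrite ?uv.
  by have [|? ? ?] := W v u uv; [rewrite uv|split=> //; rewrite orbC].
move=> _; case/infixP: uv us => p [q ->].
rewrite !index_cat !mem_cat !inE !eqxx !orbT cat_uniq => /and3P[_ /hasPn H].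
have /negbTE-> := H u (mem_head _ _).
have /negbTE-> : v \notin p by apply: H; rewrite !inE eqxx orbT.
rewrite /= inE negb_or -andbA => /and3P[/negbTE uv _ _].
by rewrite !eqxx uv; split=> //; rewrite addn0 addn1 eqxx.
Qed.

Lemma index_next s u : uniq s -> u \in s ->
  index (next s u) s = if (index u s).+1 < size s then (index u s).+1 else 0.
Proof.
move=> us su; case: s us su => // y p us su.
have iu : index u (y :: p) < size (y :: p) by rewrite index_mem.
rewrite next_nth su; case: ifP => i.
  by rewrite -(index_uniq y i us).
by rewrite nth_default /= ?eqxx //; move: i => /=; lia.
Qed.

Lemma cycle_adj_step s u v : uniq s -> cycle_adj s u v ->
  [/\ u \in s, v \in s & cyc_step (size s) (index u s) (index v s)].
Proof.
rewrite /cycle_adj /cyc_step => us.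
have iu w : w \in s -> index w s < size s by rewrite index_mem.
by case/orP=> /andP[ws /eqP->]; split; rewrite ?mem_next // index_next //;
   have := iu _ ws; case: ifP; lia.
Qed.

Lemma cycle_adj_rot s k : uniq s -> cycle_adj (rot k s) =2 cycle_adj s.
Proof. by move=> us u v; rewrite /cycle_adj !mem_rot !next_rot. Qed.

Lemma cycle_adj_rev s : uniq s -> cycle_adj (rev s) =2 cycle_adj s.
Proof.
move=> us u v; rewrite /cycle_adj !mem_rev !next_rev // orbC.
have E a b : (a \in s) && (b == prev s a) = (b \in s) && (a == next s b).
  apply/andP/andP=> [] [ms /eqP->]; split; rewrite ?mem_prev ?mem_next //.
    by rewrite next_prev.
  by rewrite prev_next.
by rewrite !E.
Qed.

(** The largest label of the zigzag on an even cycle, both for vertices and for edges. If 4 does not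
    divide [m], the edge label [m] is traded for [m + 1]. *)
Definition cycle_bound m := m + (m %% 4 != 0).

Definition cycle_labels m l :=
  (1 <= l <= cycle_bound m) && ((m %% 4 == 0) || (l != m)).

(** Positions 0 and [size s - 2] are both neighbours of the last position, so they can serve as the
    two attachments of the cycle. *)
Lemma ordered_cycle s : uniq s -> ~~ odd (size s) -> 3 <= size s ->
  exists f lam,
  [/\ ordered [set v in s] (cycle_adj s) f lam (cycle_bound (size s))
        (cycle_labels (size s)),
    forall v, index v s = 0 -> f v = 0 &
    forall v, index v s = size s - 2 -> f v = lam].
Proof.
move=> us os s3; pose k := size s %/ 4.
have [s0|s2] : size s = 4 * k \/ size s = 4 * k + 2 by rewrite /k; lia.
- have k0 : 0 < k by lia.
  have Z := zigzag_cycle0_zigzag k0.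
  exists (fun v => zigzag_cycle0 k (index v s)), (2 * k).-1; split.
  + apply: (ordered_zigzag (step := cyc_step (size s)));
      last by move=> u v /(cycle_adj_step us).
    have -> : cycle_bound (size s) = 4 * k by rewrite /cycle_bound; lia.
    rewrite s0; case: Z => [? ? ? ? ? lab]; split=> // i j Hi Hj st le.
    by rewrite /cycle_labels /cycle_bound; have := lab _ _ Hi Hj st le; lia.
  + by move=> v ->.
  + by move=> v ->; case: zigzag_cycle0P => *; lia.
- have k0 : 0 < k by lia.
  have Z := zigzag_cycle2_zigzag k0.
  exists (fun v => zigzag_cycle2 k (index v s)), (2 * k).+1; split.
  + apply: (ordered_zigzag (step := cyc_step (size s)));
      last by move=> u v /(cycle_adj_step us).
    have -> : cycle_bound (size s) = 4 * k + 3 by rewrite /cycle_bound; lia.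
    rewrite s2; case: Z => [? ? ? ? ? lab]; split=> // i j Hi Hj st le.
    by rewrite /cycle_labels /cycle_bound; have := lab _ _ Hi Hj st le; lia.
  + by move=> v ->.
  + by move=> v ->; case: zigzag_cycle2P => *; lia.
Qed.

Lemma ordered_path s n x : uniq s -> size s = n.+1 ->
  exists f, [/\ ordered [set v in s] (path_adj s) f n./2 n
      (fun l => 1 <= l <= n),
    f (head x s) = n./2 & ~~ odd n -> f (last x s) = 0].
Proof.
move=> us sn; exists (fun v => zigzag_path n./2 (index v s)); split.
- apply: (ordered_zigzag (step := lin_step));
    last by move=> u v /(path_adj_step us).
  by rewrite sn; apply: zigzag_path_zigzag.
- by case: s sn {us} => //= y s _; rewrite eqxx /zigzag_path /= subn0.
- case: s sn us => // y s [sn] us on.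
  have E : index (last x (y :: s)) (y :: s) = n.
    by rewrite [last _ _]/= index_last.
  by rewrite E /zigzag_path (negbTE on) subnn.
Qed.

Lemma cycle_rooted s y : uniq s -> y \in s ->
  exists c, [/\ uniq c, c =i s, size c = size s, cycle_adj c =2 cycle_adj s &
    next c =1 next s /\ index y c = 0].
Proof.
move=> us ys; have [i c E] := rot_to ys; exists (rot i s).
rewrite rot_uniq size_rot; split=> //.
- by move=> v; rewrite mem_rot.
- exact: cycle_adj_rot.
- by split; [exact: next_rot|rewrite E /= eqxx].
Qed.

(** The list is reversed if necessary so that [x], [w], [y] are met in this order, then rotated to
    start at [y]. *)
Lemma cycle_rooted_dist2 s x w y : uniq s -> x != y ->
    cycle_adj s x w -> cycle_adj s w y ->
  exists c, [/\ uniq c, c =i s, size c = size s, cycle_adj c =2 cycle_adj s &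
    index y c = 0 /\ index x c = size c - 2].
Proof.
move=> us xy xw wy.
have [c [uc cs sz adj [cx nx ny]]] : exists c, [/\ uniq c, c =i s,
  size c = size s,
    cycle_adj c =2 cycle_adj s & [/\ x \in c, next c x = w & next c w = y]].
  move: xw wy; rewrite /cycle_adj.
  (* Two forward steps keep [s], two backward steps call for [rev s], and one of each would give
     [x = y]. *)
  case/orP=> /andP[s1 /eqP E1] /orP[] /andP[s2 /eqP E2]; subst.
  - by exists s.
  - by case/eqP: xy; apply: (can_inj (prev_next us)).
  - by case/eqP: xy.
  - exists (rev s); rewrite rev_uniq size_rev mem_rev mem_next; split=> //.
    + by move=> v; rewrite mem_rev.
    + exact: cycle_adj_rev.
    + by split=> //; rewrite next_rev // prev_next.
have cw : w \in c by rewrite -nx mem_next.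
have cy : y \in c by rewrite -ny mem_next.
have [c' [uc' cs' sz' adj' [next' y0]]] := cycle_rooted uc cy.
exists c'; split=> //.
- by move=> v; rewrite cs'.
- by rewrite sz'.
- by move=> u v; rewrite adj'.
split=> //.
(* The successor of [w] has index 0, so [w] is last and [x] comes just before it; [x0] excludes the
   wrap-around from [x] to [w]. *)
have := index_next uc' (_ : w \in c'); rewrite next' ny y0 cs' => /(_ cw).
have := index_next uc' (_ : x \in c'); rewrite next' nx cs' => /(_ cx).
have x0 : index x c' != 0.
  apply: contraNneq xy => x0; apply/eqP.
  rewrite -(nth_index x (_ : x \in c')) ?cs' // x0 -y0 nth_index ?cs' //.
have : index x c' < size c' by rewrite index_mem cs'.
have : index w c' < size c' by rewrite index_mem cs'.
move: x0; clear; move: (index w _) (index x _) (size _) => a b d; case: ifP;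
  case: ifP; lia.
Qed.

End Ordered.

(** * Assembling the chain from its cycles and paths *)

Lemma ex_bounded_last (Q : nat -> Prop) i : 0 < i ->
  (exists2 j, 1 <= j <= i & Q j) <-> Q i \/ exists2 j, 1 <= j <= i.-1 & Q j.
Proof.
move=> i0; split=> [[j ji Qj]|[Qi|[j ji Qj]]].
- by case: (eqVneq j i) => [<-|ne]; [left|right; exists j => //; lia].
- by exists i => //; lia.
- by exists j => //; lia.
Qed.

Section Chain.
Variables (T : finType) (e : rel T) (t : nat) (m n : nat -> nat).
Variables (C P : nat -> seq T) (x0 : T).
Hypotheses (eirr : irreflexive e) (hC : cycle_chain_decomposition e t m n C P).
Hypotheses (m3 : forall i, 1 <= i <= t -> 3 <= m i).

Let h i := head x0 (P i).
Let l i := last x0 (P i).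

Let C_uniq i : 1 <= i <= t -> uniq (C i).
Proof. by case: hC => H _ _ _ _ it; have [] := H _ it. Qed.

Let C_size i : 1 <= i <= t -> size (C i) = m i.
Proof. by case: hC => H _ _ _ _ it; have [] := H _ it. Qed.

Let P_uniq i : 1 <= i <= t -> uniq (P i).
Proof. by case: hC => H _ _ _ _ it; have [] := H _ it. Qed.

Let P_size i : 1 <= i <= t -> size (P i) = (n i).+1.
Proof. by case: hC => H _ _ _ _ it; have [] := H _ it. Qed.

Let head_def i x : 1 <= i <= t -> head x (P i) = h i.
Proof. by move=> /P_size; rewrite /h; case: (P i). Qed.

Let last_def i x : 1 <= i <= t -> last x (P i) = l i.
Proof. by move=> /P_size; rewrite /l; case: (P i). Qed.

Let h_P i : 1 <= i <= t -> h i \in P i.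
Proof.
by move=> /P_size; rewrite /h; case: (P i) => //= a s _; rewrite mem_head.
Qed.

Let l_P i : 1 <= i <= t -> l i \in P i.
Proof.
by move=> /P_size; rewrite /l; case: (P i) => //= a s _; rewrite mem_last.
Qed.

Let h_C i : 1 <= i <= t -> h i \in C i.
Proof. by case: hC => _ _ [H _] _ _ it; apply: H. Qed.

Let l_C i : 1 <= i < t -> l i \in C i.+1.
Proof. by case: hC => _ _ [_ H] _ _ it; apply: H. Qed.

Let CP i j x : 1 <= i <= t -> 1 <= j <= t -> x \in C i -> x \in P j ->
  i = j /\ x = h j \/ i = j.+1 /\ x = l j.
Proof.
move=> it jt xi xj; case: hC => _ _ _ [H _ _] _.
by move: (H _ _ _ it jt xi xj); rewrite head_def // last_def.
Qed.

Let CC i j x : 1 <= i <= t -> 1 <= j <= t -> i < j -> x \in C i -> x \in C j ->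
  j = i.+1 /\ x \in P i.
Proof. by case: hC => _ _ _ [_ H _] _; apply: H. Qed.

Let PP i j x : 1 <= i <= t -> 1 <= j <= t -> x \in P i -> x \in P j -> i = j.
Proof. by case: hC => _ _ _ [_ _ H] _; apply: H. Qed.

Let edgeP u v : e u v -> exists2 i, 1 <= i <= t &
  cycle_adj (C i) u v \/ path_adj (P i) u v.
Proof.
case: hC => _ [_ H] _ _ _ /H[i it /orP uv]; by exists i.
Qed.

(** The distance is measured in the whole graph, so the walk of length 2 must be shown to stay in
    [C i.+1]. An edge off this cycle puts [w] in [C i] or [P i] (next to [l i]), or in [P i.+1] or
    [C i.+2] (next to [h i.+1]). The two sides are disjoint, and they meet [C i.+1] only in [l i]
    and [h i.+1] respectively. *)
Lemma attachments_dist2 i : 1 <= i < t ->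
  l i != h i.+1 /\
  exists2 w, cycle_adj (C i.+1) (l i) w & cycle_adj (C i.+1) w (h i.+1).
Proof.
move=> it; have it1 : 1 <= i <= t by lia.
have it2 : 1 <= i.+1 <= t by lia.
set x := l i; set y := h i.+1.
have [[p pth [lst sz]] mn] : at_distance e 2 x y.
  by case: hC => _ _ _ _ /(_ i x0 it).
have xy : x != y by apply/eqP => E; have := mn [::] isT E.
split=> //.
case: p pth sz lst mn => [|w [|y' [|]]] //= /and3P[xw wy' _] _ Ey _.
move: wy'; rewrite {}Ey => wy.
have inC j u v : 1 <= j <= t -> cycle_adj (C j) u v -> u \in C j /\ v \in C j.
  by move=> jt /cycle_adj_step[|->] //; exact: C_uniq.
have inP j u v : 1 <= j <= t -> path_adj (P j) u v -> u \in P j /\ v \in P j.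
  by move=> jt /path_adj_step[|->] //; exact: P_uniq.
have xw' : x != w by apply: contraTneq xw => ->; rewrite eirr.
have wy' : w != y by apply: contraTneq wy => ->; rewrite eirr.
have xP : x \in P i by apply: l_P.
have yP : y \in P i.+1 by apply: h_P.
have xC : x \in C i.+1 by apply: l_C.
have yC : y \in C i.+1 by apply: h_C.
have H1 : cycle_adj (C i.+1) x w \/ w \in C i \/ w \in P i.
  have [j jt [c|c]] := edgeP xw.
    have [xj wj] := inC _ _ _ jt c.
    by case: (CP jt it1 xj xP) => [[E _]|[E _]]; move: c wj; rewrite E; auto.
  have [xj wj] := inP _ _ _ jt c.
  by move: wj; rewrite (PP jt it1 xj xP); auto.
have H2 : cycle_adj (C i.+1) w y \/ w \in P i.+1 \/ i.+2 <= t /\ w \in C i.+2.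
  have [j jt [c|c]] := edgeP wy.
    have [wj yj] := inC _ _ _ jt c.
    by case: (CP jt it2 yj yP) => [[E _]|[E _]]; move: c wj jt; rewrite E;
      auto; lia.
  have [wj yj] := inP _ _ _ jt c.
  by move: wj; rewrite (PP jt it2 yj yP); auto.
have no1 : w \in C i.+1 -> w \in C i \/ w \in P i -> False.
  move=> w1 H; have wP : w \in P i.
    by case: H => // wi; have [] := CC it1 it2 (ltnSn i) wi w1.
  case: (CP it2 it1 w1 wP) => [[E _]|[_ E]]; first by clear - E; lia.
  by case/eqP: xw'; rewrite E.
have no2 : w \in C i.+1 -> w \in P i.+1 \/ i.+2 <= t /\ w \in C i.+2 -> False.
  move=> w1 H; have wP : w \in P i.+1.
    case: H => // [[ti wi]].
    have it3 : 1 <= i.+2 <= t by rewrite ti.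
    by have [] := CC it2 it3 (ltnSn _) w1 wi.
  case: (CP it2 it2 w1 wP) => [[_ E]|[E _]]; last by clear - E; lia.
  by case/eqP: wy'; rewrite E.
case: H1 => [c1|H1]; case: H2 => [c2|H2].
- by exists w.
- by case: no2 => //; have [] := inC _ _ _ it2 c1.
- by case: no1 => //; have [] := inC _ _ _ it2 c2.
- case: H1 H2 => [w1|w1] [w2|[ti w2]].
  + by case: (CP it1 it2 w1 w2) => [[E _]|[E _]]; clear - E; lia.
  + have it3 : 1 <= i.+2 <= t by rewrite ti.
    by have [E _] := CC it1 it3 (ltnW (ltnSn _)) w1 w2; clear - E; lia.
  + by have E := PP it1 it2 w1 w2; clear - E; lia.
  + have it3 : 1 <= i.+2 <= t by rewrite ti.
    by case: (CP it3 it1 w2 w1) => [[E _]|[E _]]; clear - E; lia.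
Qed.

(* The union of the first [a] cycles and [b] paths; [z] says whether [y] is
   known to be labeled 0, i.e. available for nesting into a larger block. *)
Definition block a b (z : bool) y N (L : nat -> Prop) :=
  exists (V : {set T}) (r : T -> T -> Prop) f lam,
  [/\ ordered V r f lam N L, z -> f y = 0,
      forall v, v \in V <-> (exists2 j, 1 <= j <= a & v \in C j) \/
                            (exists2 j, 1 <= j <= b & v \in P j) &
      forall u v, r u v <-> (exists2 j, 1 <= j <= a & cycle_adj (C j) u v) \/
                            (exists2 j, 1 <= j <= b & path_adj (P j) u v)].

(** The path is the outer labeling: its first vertex, labeled [lam], meets the 0 of the block. For
    even [n i] its last vertex is labeled 0 and keeps this label, being low. *)
Lemma block_path i N L d1 d2 (L' : nat -> Prop) : 1 <= i <= t ->
    block i i.-1 true (h i) N L -> N + d2 <= d1 ->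
    (forall k, 1 <= k <= n i -> L' (k + d1)) ->
    (forall k, L k -> L' (k + d2)) ->
  block i i (~~ odd (n i)) (l i) (n i + d1) L'.
Proof.
move=> it [V [r [f [lam [o f0 sV sr]]]]] Nd L1 L2.
have [g [og gh gl]] := ordered_path x0 (P_uniq it) (P_size it).
have VI : [set v in P i] :&: V = [set h i].
  apply/setP => v; rewrite !inE; apply/andP/eqP =>
    [[vi /sV[[j ji vj]|[j ji vj]]]|->].
  - have jt : 1 <= j <= t by lia.
    by case: (CP jt it vj vi) => [[_ ->]|[]] //; lia.
  - have jt : 1 <= j <= t by lia.
    by have := PP it jt vi vj; lia.
  - split; first exact: h_P.
    by apply/sV; left; exists i; [lia|exact: h_C].
have [F [oF FE]] := ordered_glue og o VI gh (f0 isT) Nd L1 L2.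
exists ([set v in P i] :|: V), (fun u v => path_adj (P i) u v \/ r u v), F,
  ((n i)./2 + lam).
have i0 : 0 < i by lia.
split=> //.
- by move=> ev; rewrite FE ?gl ?inE ?l_P.
- move=> v; rewrite (ex_bounded_last (fun j => v \in P j) i0) !inE.
  have E := sV v; clear - E.
  by split=> [/orP[]|H]; try (apply/orP); tauto.
- by move=> u v; rewrite (ex_bounded_last (fun j =>
    is_true (path_adj (P j) u v)) i0) sr; tauto.
Qed.

Lemma block_cycle1 : 0 < t -> ~~ odd (m 1) ->
  block 1 0 true (h 1) (cycle_bound (m 1)) (cycle_labels (m 1)).
Proof.
move=> t0 om; have it : 1 <= 1 <= t by lia.
have [c [uc cs sz adj [_ y0]]] := cycle_rooted (C_uniq it) (h_C it).
have szm : size c = m 1 by rewrite sz C_size.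
have [||f [lam [o f0 _]]] := ordered_cycle uc; rewrite ?szm //; first exact: m3.
rewrite szm in o.
exists [set v in c], (cycle_adj c), f, lam; split=> //.
- by move=> _; apply: f0.
- move=> v; rewrite (ex_bounded_last (fun j => v \in C j) (ltn0Sn 0)) inE cs.
  split; first by left; left.
  by case=> [[//|]|] [j]; lia.
- move=> u v; rewrite (ex_bounded_last (fun j =>
    is_true (cycle_adj (C j) u v)) (ltn0Sn 0)) adj.
  split; first by left; left.
  by case=> [[//|]|] [j]; lia.
Qed.

(** The cycle is the outer labeling, with shifts [N] for its own edge labels and 0 for those of the
    block. It is rooted so that [l i] is its [lam] and [h i.+1] its 0. *)
Lemma block_cycle i N L (L' : nat -> Prop) : 1 <= i < t -> ~~ odd (m i.+1) ->
    block i i true (l i) N L ->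
    (forall k, cycle_labels (m i.+1) k -> L' (k + N)) ->
    (forall k, L k -> L' k) ->
  block i.+1 i true (h i.+1) (cycle_bound (m i.+1) + N) L'.
Proof.
move=> it om [V [r [f [lam [o f0 sV sr]]]]] L1 L2.
have it1 : 1 <= i <= t by lia.
have it2 : 1 <= i.+1 <= t by lia.
have [xy [w xw wy]] := attachments_dist2 it.
have [c [uc cs sz adj [y0 x2]]] := cycle_rooted_dist2 (C_uniq it2) xy xw wy.
have szm : size c = m i.+1 by rewrite sz C_size.
have [||g [mu [og g0 gl]]] := ordered_cycle uc; rewrite ?szm //;
  first exact: m3.
rewrite szm in og.
have VI : [set v in c] :&: V = [set l i].
  apply/setP => v; rewrite !inE cs;
    apply/andP/eqP => [[vi /sV[[j ji vj]|[j ji vj]]]|->].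
  - have jt : 1 <= j <= t by clear - ji it1; lia.
    have ji' : j < i.+1 by clear - ji; lia.
    have [E vP] := CC jt it2 ji' vj vi.
    case: (CP it2 jt vi vP) => [[E' _]|[[<-] -> //]].
    by clear - ji E'; lia.
  - have jt : 1 <= j <= t by clear - ji it1; lia.
    case: (CP it2 jt vi vj) => [[E _]|[[<-] -> //]].
    by clear - ji E; lia.
  - split; first exact: l_C.
    by apply/sV; right; exists i; [lia|exact: l_P].
have NN : N + 0 <= N by rewrite addn0.
have L2' k : L k -> L' (k + 0) by rewrite addn0; apply: L2.
have [F [oF FE]] := ordered_glue og o VI (gl _ x2) (f0 isT) NN L1 L2'.
exists ([set v in c] :|: V), (fun u v => cycle_adj c u v \/ r u v), F,
  (mu + lam).
split=> //.
- by move=> _; rewrite FE ?g0 // inE cs h_C.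
- move=> v; rewrite (ex_bounded_last (fun j => v \in C j) (ltn0Sn i)) !inE cs.
  have E := sV v; clear - E.
  by split=> [/orP[]|H]; try (apply/orP); tauto.
- move=> u v; rewrite (ex_bounded_last (fun j =>
    is_true (cycle_adj (C j) u v)) (ltn0Sn i)) sr adj.
  by tauto.
Qed.

Lemma block_labels a b z y N (L L' : nat -> Prop) :
  (forall k, L k -> L' k) -> block a b z y N L -> block a b z y N L'.
Proof.
move=> LL [V [r [f [lam [[inj le lamN adj unq lab] f0 sV sr]]]]].
exists V, r, f, lam; split=> //; split=> // u v uv lu.
exact/LL/lab.
Qed.

(** Here [N] counts the edges so far: each new piece with q edges brings the labels 1..q, raised by
    exactly the previous count, so these partial labelings are alpha-labelings. *)
Lemma block_alpha i : (forall j, 1 <= j < t -> m j %% 4 = 0 /\ ~~ odd (n j)) ->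
    1 <= i < t ->
  let N := \sum_(1 <= j < i.+1) m j + \sum_(1 <= j < i.+1) n j in
  block i i true (l i) N (fun k => 1 <= k <= N).
Proof.
move=> mn4; elim: i => [|i IH] it; first by lia.
have [mi ni] := mn4 _ it.
have om : ~~ odd (m i.+1) by lia.
have bm : cycle_bound (m i.+1) = m i.+1 by rewrite /cycle_bound; lia.
have it1 : 1 <= i.+1 <= t by lia.
(* Intermediate block: the cycle [C i.+1] is added, the path [P i.+1] is not yet. *)
suff B : block i.+1 i true (h i.+1)
    (m i.+1 + (\sum_(1 <= j < i.+1) m j + \sum_(1 <= j < i.+1) n j))
    (fun k => 1 <= k <=
       m i.+1 + (\sum_(1 <= j < i.+1) m j + \sum_(1 <= j < i.+1) n j)).
  rewrite /= !(big_nat_recr i.+1) //=.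
  set M := (X in m _ + X) in B.
  have := block_path (d1 := m i.+1 + M) (d2 := 0)
    (L' := fun k => 1 <= k <= n i.+1 + (m i.+1 + M)) it1 B.
  rewrite ni; have -> : \sum_(1 <= j < i.+1) m j + m i.+1 +
      (\sum_(1 <= j < i.+1) n j + n i.+1) = n i.+1 + (m i.+1 + M).
    by rewrite /M; lia.
  by apply; lia.
case: (posnP i) => [i0|i0].
  move: bm om; rewrite i0 !big_geq // !addn0 => bm om.
  have t0 : 0 < t by lia.
  rewrite -{1}bm; apply: block_labels (block_cycle1 t0 om) => k.
  by rewrite /cycle_labels bm; lia.
have it' : 1 <= i < t by lia.
rewrite -{1}bm; apply: block_cycle (IH it') _ _ => // k;
  rewrite /cycle_labels ?bm; lia.
Qed.

(** * The last cycle, the last path and the conclusion *)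

Lemma chain_uniformly_ordered : 0 < t -> symmetric e -> ~~ odd (m t) ->
    (forall j, 1 <= j < t -> m j %% 4 = 0 /\ ~~ odd (n j)) ->
    #|edges e| = \sum_(1 <= i < t.+1) m i + \sum_(1 <= i < t.+1) n i ->
  exists f : T -> nat, uniformly_ordered_labeling e f.
Proof.
move=> t0 esym om mn4; rewrite !(big_nat_recr t) //=.
set M := \sum_(1 <= i < t) m i; set W := \sum_(1 <= i < t) n i => Ecard.
have tt : 1 <= t <= t by lia.
(* Everything but the last path. If 4 does not divide [m t], the label [m t] missing on the last
   cycle is lifted to [m t + (M + W)], the number of edges so far. *)
have B : block t t.-1 true (h t) (cycle_bound (m t) + (M + W)) (fun k =>
    (1 <= k <= cycle_bound (m t) + (M + W)) &&
      ((m t %% 4 == 0) || (k != m t + (M + W)))).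
  have [t1|t1] : t = 1 \/ 1 < t by lia.
    have M0 : M + W = 0 by rewrite /M /W t1 !big_geq.
    rewrite M0 !addn0 t1; rewrite t1 in om.
    exact: block_cycle1.
  have it : 1 <= t.-1 < t by lia.
  have tE : t.-1.+1 = t by lia.
  have := block_alpha mn4 it; rewrite /= tE -/M -/W => B.
  rewrite -tE; apply: block_cycle B _ _ => //; rewrite tE // => k.
    by rewrite /cycle_labels; lia.
  by rewrite /cycle_bound; have := m3 tt; lia.
set E2 := m t + (M + W).
have NE : cycle_bound (m t) + (M + W) <= E2 + (m t %% 4 != 0)
  by rewrite /E2 /cycle_bound; lia.
(* With this [d1] the vertex bound [n t + d1] is exactly twice the total number [E2 + n t] of edges.
   No nesting follows, so the far end may carry any label and [n t] may be odd. *)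
have := block_path (d1 := 2 * E2 + n t) (d2 := n t) (L' := fun k =>
   (2 * E2 + n t < k <= 2 * E2 + 2 * n t) ||
   [&& n t < k, k <= n t + E2 + (m t %% 4 != 0) &
       (m t %% 4 == 0) || (k != n t + E2)]) tt B.
case.
- by have := m3 tt; lia.
- by move=> k; lia.
- by move=> k; lia.
move=> V [r [f [lam [o _ sV sr]]]]; exists f.
have [_ [cov adj] _ _ _] := hC.
have VT : V = [set: T].
  apply/setP => v; rewrite inE; apply/sV.
  by have [j jt /orP[vj|vj]] := cov v; [left|right]; exists j.
have er u v : e u v <-> r u v.
  rewrite adj sr; split; first by case=> j jt /orP[c|c]; [left|right]; exists j.
  by case=> [[j jt c]|[j jt c]]; exists j; rewrite ?c ?orbT.
apply: ordered_uniformly (ordered_eq VT er o) esym _ _; rewrite Ecard.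
- by rewrite /E2; lia.
(* The partners of the top [n t] labels are 1..[n t], which do not occur. Those of
   [n t + 1]..[n t + E2] start at [n t + E2 + 1], which occurs only if its own partner [n t + E2] is
   excluded. *)
- by move=> k; rewrite -/E2; have := m3 tt; rewrite /E2; lia.
Qed.

End Chain.

Theorem theorem5 (t : nat) (m n : nat -> nat) (T : finType) (e : rel T)
    (ht : 1 <= t)
    (hm : forall i, 1 <= i <= t -> 3 <= m i)
    (hmt : m t = 0 %[mod 2])
    (hmn : 2 <= t -> forall i, 1 <= i <= t - 1 ->
             m i = 0 %[mod 4] /\ n i = 0 %[mod 2])
    (esym : symmetric e) (eirr : irreflexive e)
    (hG : is_cycle_chain e t m n) :
  exists f : T -> nat, uniformly_ordered_labeling e f.
Proof.
case: hG => _ cardE [C [P hC]].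
(* A default vertex for [head] and [last]. *)
have [x0 _] : exists x, x \in C 1.
  have [/(_ 1) H _ _ _ _] := hC.
  have [|_ sz _ _] := H; first by rewrite ht.
  have := hm 1; rewrite ht -sz; case: (C 1) => [/(_ isT)//|x s _].
  by exists x; rewrite mem_head.
apply: (chain_uniformly_ordered x0 eirr hC hm) => //; first by lia.
by move=> j jt; have [||mj nj] := hmn _ j; lia.
Qed.
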